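(* Let $m\ge 1$, let $\xi_1,\ldots,\xi_m\in\mathbb{R}$ with $\xi_1<\ldots<\xi_m$, put $\xi_{m+1}:=\xi_m+1$, and let $\alpha_1,\ldots,\alpha_m,\beta_1,\ldots,\beta_m\in\mathbb{R}$. Let $0<\varkappa<1$ be fixed. Then there exist functions $g,h:\mathbb{R}\to\mathbb{R}$ such that 1. $g(h(z))=z$ for all $z\in\mathbb{R}$ and $h(g(x))=x$ for all $x\in\mathbb{R}$; 2. $g,h\in C^1(\mathbb{R})$; 3. $\|g'-1\|_\infty\le\varkappa$ and $\|h'-1\|_\infty\le\varkappa$; 4. $\sup_{x\in\mathbb{R}}|g(x)-x|\le\frac{\varkappa}{2}\max\left(1,\max_{1\le k\le m}(\xi_{k+1}-\xi_k)\right)$, and $g(x)=x$ for $|x|$ sufficiently large; 5. $g'',h''$ are piecewise continuous and bounded on $\mathbb{R}$, both one-sided limits of $g''$ at $\xi_k$ exist, and both one-sided limits of $h''$ at $g(\xi_k)$ exist, for $k=1,\ldots,m$; 6. $g''(\xi_k+)=\alpha_k$ and $g''(\xi_k-)=\beta_k$ for $k=1,\ldots,m$.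
   Context: $f(x+)$ and $f(x-)$ denote the right and left limits of $f$ at $x$. $\|\cdot\|_\infty$ is the supremum norm on $\mathbb{R}$. The second derivatives $g''$ and $h''$ are understood to exist except possibly at finitely many points (such as the points $\xi_k$, resp. $g(\xi_k)$), and ''piecewise continuous and bounded'' refers to the functions on the complement of such a finite set. *)

(* Defs.v *)
From HB Require Import structures.
From mathcomp Require Import all_boot all_order all_algebra.
From mathcomp Require Import all_classical all_reals all_analysis.

Set Implicit Arguments.
Unset Strict Implicit.
Unset Printing Implicit Defensive.

Import Order.TTheory GRing.Theory Num.Theory.
Import numFieldNormedType.Exports.

Local Open Scope ring_scope.
Local Open Scope classical_set_scope.

(* Extended-real valued, since the real-valued [sup] of an unbounded set is 0. *)
Definition sup_norm (R : realType) (f : R -> R) : \bar R :=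
  ereal_sup (range (fun x => `|f x|%:E)).

Definition C1 (R : realType) (f : R -> R) : Prop :=
  (forall x, derivable f x 1) /\ continuous f^`().

Definition has_one_sided_limits (R : realType) (f : R -> R) (x : R) : Prop :=
  cvg (f y @[y --> x^'+]) /\ cvg (f y @[y --> x^'-]).

(* The values of [f] on the finite set [S] are immaterial. *)
Definition piecewise_continuous_off (R : realType) (S : seq R) (f : R -> R) :
    Prop :=
  (forall x, x \notin S -> {for x, continuous f}) /\
  (forall x, x \in S -> has_one_sided_limits f x).

Definition bounded_off (R : realType) (S : seq R) (f : R -> R) : Prop :=
  exists M : R, forall x, x \notin S -> `|f x| <= M.

(* [f^`(2)] is total; at the points of [S], where [f^`()] need not be
   derivable, its value is never used. *)
Definition piecewise_second_derivative (R : realType) (f : R -> R) : Prop :=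
  exists S : seq R,
    [/\ forall x, x \notin S -> derivable f^`() x 1,
        piecewise_continuous_off S f^`(2)
      & bounded_off S f^`(2)].

(* With nodes [xi_1 < ... < xi_m] stored at indices 0, ..., m-1, this is
   [xi_(k+1)], where [xi_(m+1) := xi_m + 1]. *)
Definition next_node (R : realType) (m : nat) (xi : 'I_m -> R) (k : 'I_m) : R :=
  oapp xi (xi k + 1) (insub k.+1).

(* Main.v *)
Require Import Defs.
From HB Require Import structures.
From mathcomp Require Import all_boot all_order all_algebra.
From mathcomp Require Import all_classical all_reals all_analysis.
From mathcomp Require Import ring lra.

Set Implicit Arguments.
Unset Strict Implicit.
Unset Printing Implicit Defensive.

Import Order.TTheory GRing.Theory Num.Theory.
Import numFieldNormedType.Exports.

Local Open Scope ring_scope.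
Local Open Scope classical_set_scope.

(* Near each node the identity is corrected by a bump r^2 B((x - xi_k) / r),
   where B equals (a t^2 / 2) (1 - t^2)^3 for 0 <= t <= 1, (b t^2 / 2) (1 - t^2)^3
   for -1 <= t <= 0, and 0 elsewhere.  The second derivative of the bump jumps
   from b = beta_k to a = alpha_k whatever r is, while its value and its first
   derivative are O(r).  For r small no bump is felt at the node of another one,
   and |g' - 1| <= kappa / 2, so that g is a bijection and its inverse h has
   |h' - 1| = |g' - 1| / g' <= kappa, evaluated at h. *)

Lemma continuous_of_is_derive (R : realType) (f df : R -> R) :
  (forall x : R, is_derive x 1 f (df x)) -> continuous f.
Proof.
move=> fdf x; apply/differentiable_continuous/derivable1_diffP.
by have [] := fdf x.
Qed.

(** * Derivatives of the positive part and of its square *)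

Section PositivePart.
Context {R : realType}.
Implicit Types x t : R.

Definition pos_part x : R := Num.max x 0.

Lemma continuous_pos_part : continuous pos_part.
Proof.
move=> x; apply: (@continuous_max _ _ id (cst 0)); first exact: cvg_id.
exact: cvg_cst.
Qed.

Lemma pos_part_gt0 x : 0 < x -> pos_part x = x.
Proof. by move=> x0; apply/max_idPl/ltW. Qed.

Lemma pos_part_le0 x : x <= 0 -> pos_part x = 0.
Proof. by move=> x0; apply/max_idPr. Qed.

Lemma pos_part_itv01 x : x <= 1 -> 0 <= pos_part x <= 1.
Proof. by move=> x1; rewrite /pos_part le_max lexx orbT ge_max x1 ler01. Qed.

Lemma is_derive_pos_part x : x != 0 -> is_derive x 1 pos_part (0 < x)%R%:R.
Proof.
rewrite neq_lt => /orP[x0|x0].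
  rewrite ltNge (ltW x0); apply: (@near_eq_is_derive _ _ _ (cst 0)) => //.
  near=> y; rewrite pos_part_le0// ltW//.
  by near: y; exact: lt_nbhsl.
rewrite x0; apply: (@near_eq_is_derive _ _ _ id) => //.
near=> y; rewrite pos_part_gt0//.
by near: y; exact: lt_nbhsr.
Unshelve. all: by end_near. Qed.

(** Squaring removes the kink at 0, so the chain rule applies even where [f] vanishes. *)
Lemma is_derive_pos_part_sqr (f : R -> R) x df : is_derive x 1 f df ->
  is_derive x 1 (fun y => pos_part (f y) ^+ 2) (2 * pos_part (f x) * df).
Proof.
suff sqr (z : R) : is_derive z 1 (fun y => pos_part y ^+ 2) (2 * pos_part z).
  by move=> fx; exact: (@is_derive1_comp _ (fun y => pos_part y ^+ 2) f).
have [->|z0] := eqVneq z 0.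
  (* The slope function at 0 is [pos_part] itself, because [pos_part y ^+ 2 = pos_part y * y]; it is
     continuous and vanishes at 0. *)
  apply/is_derive1_caratheodory; exists pos_part; split.
  - by move=> y; rewrite /pos_part maxxx; case: leP => y0; ring.
  - exact: continuous_pos_part.
  - by rewrite /pos_part maxxx mulr0.
have dz := is_derive_pos_part z0.
apply: is_derive_eq; rewrite /GRing.scale/=.
by move: z0; rewrite /pos_part; case: ltgtP => // z0 _ /=; ring.
Qed.

End PositivePart.

(** * The bump at scale 1 and its first two derivatives *)

Section Bump.
Context {R : realType}.
Variables (a b : R).
Implicit Types d t : R.

(** Away from 0, [side_square / 2], [side_linear] and [side_slope] are successive derivatives. Only
    the last one jumps at 0, from [b] to [a]. *)
Definition side_slope t : R := a * (0 < t)%R%:R + b * (t < 0)%R%:R.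
Definition side_linear t : R := a * pos_part t - b * pos_part (- t).
Definition side_square t : R := a * pos_part t ^+ 2 + b * pos_part (- t) ^+ 2.
(* The bump contains the cube of [cap], which makes it C^2 at [1] and [-1]. *)
Definition cap t : R := pos_part (1 - t ^+ 2).

Lemma is_derive_side_square t : is_derive t 1 side_square (2 * side_linear t).
Proof.
have dp := @is_derive_pos_part_sqr _ id t 1 _.
have dn := @is_derive_pos_part_sqr _ -%R t (-1) _.
rewrite /side_square; apply: is_derive_eq.
by rewrite /GRing.scale/= /side_linear; ring.
Qed.

Lemma is_derive_side_linear t : t != 0 -> is_derive t 1 side_linear (side_slope t).
Proof.
move=> t0; have dp := is_derive_pos_part t0.
have dn : is_derive t 1 (fun y => pos_part (- y)) ((t < 0)%R%:R * -1).
  apply: (@is_derive1_comp _ pos_part -%R).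
  by rewrite -oppr_gt0; apply: is_derive_pos_part; rewrite oppr_eq0.
rewrite /side_linear; apply: is_derive_eq.
by rewrite /GRing.scale/= /side_slope; ring.
Qed.

Lemma is_derive_cap2 t : is_derive t 1 (fun t => cap t ^+ 2) (-4 * t * cap t).
Proof.
have -> : -4 * t * cap t = 2 * pos_part (1 - t ^+ 2) * (-2 * t).
  by rewrite /cap; ring.
apply: (@is_derive_pos_part_sqr _ (fun t => 1 - t ^+ 2)); apply: is_derive_eq.
by rewrite /GRing.scale/=; ring.
Qed.

(** Either [cap] vanishes or it equals [1 - t ^+ 2]. This trades a factor [cap], which has kinks at
    1 and -1, for a polynomial, so that the cube can be differentiated through the square. *)
Lemma cap_mul t : cap t * (1 - t ^+ 2) = cap t ^+ 2.
Proof. by rewrite /cap /pos_part; case: leP => _; ring. Qed.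

Lemma is_derive_cap3 t :
  is_derive t 1 (fun t => cap t ^+ 3) (-6 * t * cap t ^+ 2).
Proof.
have cap3 y : cap y ^+ 3 = cap y ^+ 2 * (1 - y ^+ 2).
  by rewrite exprS -{1}cap_mul; ring.
under eq_fun do rewrite cap3.
have d2 := is_derive_cap2 t; apply: is_derive_eq.
by rewrite /GRing.scale/= -cap_mul; ring.
Qed.

Definition bump t : R := side_square t / 2 * cap t ^+ 3.

Definition bump1 t : R :=
  side_linear t * cap t ^+ 3 - 3 * t * side_square t * cap t ^+ 2.

(** The second derivative with its discontinuous factor [side_slope t] frozen to a constant [d]. For
    fixed [d] it is continuous with value [d] at 0, and both one-sided limits at 0 are read off from
    [d = a] and [d = b]. *)
Definition bump2_aux d t : R :=
  d * cap t ^+ 3 - 12 * t * side_linear t * cap t ^+ 2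
  - 3 * side_square t * cap t ^+ 2 + 12 * t ^+ 2 * side_square t * cap t.

Definition bump2 t : R := bump2_aux (side_slope t) t.

Lemma is_derive_bump t : is_derive t 1 bump (bump1 t).
Proof.
have ds := is_derive_side_square t; have d3 := is_derive_cap3 t.
rewrite /bump; apply: is_derive_eq.
by rewrite /GRing.scale/= /bump1; field.
Qed.

Lemma is_derive_bump1 t : t != 0 -> is_derive t 1 bump1 (bump2 t).
Proof.
move=> t0; have dl := is_derive_side_linear t0.
have ds := is_derive_side_square t.
have d2 := is_derive_cap2 t; have d3 := is_derive_cap3 t.
rewrite /bump1; apply: is_derive_eq.
by rewrite /GRing.scale/= /bump2 /bump2_aux; ring.
Qed.

Lemma continuous_side_linear : continuous side_linear.
Proof.
move=> t; apply: cvgB; (apply: cvgM; first exact: cvg_cst).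
  exact: continuous_pos_part.
apply: (cvg_comp _ pos_part (@oppr_continuous R R t)).
exact: continuous_pos_part.
Qed.

Lemma continuous_side_square : continuous side_square.
Proof. exact: continuous_of_is_derive is_derive_side_square. Qed.

Lemma continuous_cap : continuous cap.
Proof.
move=> t; apply: (cvg_comp (fun t => 1 - t ^+ 2) pos_part).
  by apply: cvgB; [exact: cvg_cst|exact: exprn_continuous].
exact: continuous_pos_part.
Qed.

Lemma continuous_capX n : continuous (fun t => cap t ^+ n).
Proof.
move=> t; apply: (cvg_comp cap (fun x => x ^+ n)).
  exact: continuous_cap.
exact: exprn_continuous.
Qed.

Lemma continuous_bump1 : continuous bump1.
Proof.
move=> t; apply: cvgB; apply: cvgM; try exact: continuous_capX.
  exact: continuous_side_linear.
apply: cvgM; last exact: continuous_side_square.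
by apply: cvgM; [exact: cvg_cst|exact: cvg_id].
Qed.

Lemma continuous_bump2_aux d : continuous (bump2_aux d).
Proof.
move=> t; apply: cvgD; last first.
  apply: cvgM; last exact: continuous_cap.
  apply: cvgM; last exact: continuous_side_square.
  by apply: cvgM; [exact: cvg_cst|exact: exprn_continuous].
apply: cvgB.
  apply: cvgB.
    by apply: cvgM; [exact: cvg_cst|exact: continuous_capX].
  apply: cvgM; last exact: continuous_capX.
  apply: cvgM; last exact: continuous_side_linear.
  by apply: cvgM; [exact: cvg_cst|exact: cvg_id].
apply: cvgM; last exact: continuous_capX.
by apply: cvgM; [exact: cvg_cst|exact: continuous_side_square].
Qed.

Lemma bump2_aux0 d : bump2_aux d 0 = d.
Proof.
rewrite /bump2_aux /side_square /cap oppr0 expr0n subr0 /pos_part maxxx.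
by rewrite (max_idPl ler01); ring.
Qed.

Lemma cap_eq0 t : 1 <= `|t| -> cap t = 0.
Proof.
move=> t1; apply: pos_part_le0; rewrite subr_le0.
by rewrite -real_normK ?num_real// exprn_ege1.
Qed.

Lemma bump_supp t : 1 <= `|t| -> [/\ bump t = 0, bump1 t = 0 & bump2 t = 0].
Proof.
by move=> /cap_eq0 t0; rewrite /bump /bump1 /bump2 /bump2_aux t0; split; ring.
Qed.

(* 28 = 1 + 12 + 3 + 12, the coefficients in [bump2_aux]. *)
Definition bump_bound : R := 28 * (`|a| + `|b|).

(** Outside [-1, 1] all three vanish. Inside, [t], [cap t] and the positive parts are at most 1 in
    absolute value, so each side function is at most [A] and each term at most its coefficient times
    [A]. *)
Lemma bump_le t : [/\ `|bump t| <= bump_bound, `|bump1 t| <= bump_bound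
  & `|bump2 t| <= bump_bound].
Proof.
rewrite /bump_bound; set A := `|a| + `|b|.
have a0 := normr_ge0 a; have b0 := normr_ge0 b.
have A0 : 0 <= A by rewrite addr_ge0.
have [/bump_supp[-> -> ->]|/ltW] := leP 1 `|t|.
  by rewrite normr0; split; lra.
move=> t1; have := t1; rewrite ler_norml => /andP[tl tr].
have /andP[c0 c1] : 0 <= cap t <= 1.
  by apply: pos_part_itv01; have := sqr_ge0 t; lra.
have c0n : `|cap t| <= 1 by rewrite ger0_norm.
have combo (u v x y : R) : `|x| <= `|a| -> `|y| <= `|b| -> `|x + y| <= A.
  by move=> xa yb; rewrite (le_trans (ler_normD _ _))// lerD.
have pos01 x : x <= 1 -> `|pos_part x| <= 1.
  by move=> /pos_part_itv01 /andP[p0 p1]; rewrite ger0_norm.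
have mul_le (M x y : R) : `|x| <= M -> `|y| <= 1 -> `|x * y| <= M.
  move=> xM y1; rewrite normrM (le_trans _ xM)// ler_piMr//.
have tn : - t <= 1 by lra.
have slopeA : `|side_slope t| <= A.
  by apply: combo => //; apply: mul_le => //; case: ltP => _; rewrite ?normr1 ?normr0.
have linA : `|side_linear t| <= A.
  by apply: combo => //; rewrite ?normrN; apply: mul_le => //; exact: pos01.
have sqrA : `|side_square t| <= A.
  apply: combo => //; apply: mul_le => //; rewrite normrX exprn_ile1//; exact: pos01.
have capX n : `|cap t ^+ n| <= 1 by rewrite normrX exprn_ile1.
have t2 : `|t ^+ 2| <= 1 by rewrite normrX exprn_ile1.
split.
- have := mul_le _ _ _ sqrA (capX 3); rewrite ler_norml => /andP[l r].
  by rewrite /bump ler_norml; apply/andP; split; lra.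
- have := mul_le _ _ _ linA (capX 3); rewrite ler_norml => /andP[l1 r1].
  have := mul_le _ _ _ (mul_le _ _ _ sqrA (capX 2)) t1.
  rewrite ler_norml => /andP[l2 r2].
  by rewrite /bump1 ler_norml; apply/andP; split; lra.
- have := mul_le _ _ _ slopeA (capX 3); rewrite ler_norml => /andP[l1 r1].
  have := mul_le _ _ _ (mul_le _ _ _ linA (capX 2)) t1.
  rewrite ler_norml => /andP[l2 r2].
  have := mul_le _ _ _ sqrA (capX 2); rewrite ler_norml => /andP[l3 r3].
  have := mul_le _ _ _ (mul_le _ _ _ sqrA c0n) t2.
  rewrite ler_norml => /andP[l4 r4].
  by rewrite /bump2 /bump2_aux ler_norml; apply/andP; split; lra.
Qed.

End Bump.

(** * C^1 functions with a piecewise continuous, bounded second derivative *)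

Section PiecewiseC2.
Context {R : realType}.
Implicit Types (S : seq R) (f g h : R -> R) (x y : R).

(** The derivatives are carried as explicit functions, so that sums and inverses act on formulas.
    One-sided limits and the bound are asked of [f2] at every point, which spares a case distinction
    on [S] in those constructions. *)
Record piecewise_C2 S f f1 f2 : Prop := PiecewiseC2 {
  pC2_derive : forall x, is_derive x 1 f (f1 x);
  pC2_continuous1 : continuous f1;
  pC2_derive1 : forall x, x \notin S -> is_derive x 1 f1 (f2 x);
  pC2_continuous2 : forall x, x \notin S -> {for x, continuous f2};
  pC2_limits2 : forall x, has_one_sided_limits f2 x;
  pC2_bounded2 : exists M, forall x, `|f2 x| <= M }.

Lemma near_notin S x : x \notin S -> \forall y \near x, y \notin S.
Proof.
elim: S => [|s S IH]; first by move=> _; near=> y.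
rewrite inE negb_or neq_lt => /andP[xs /IH xS]; near=> y.
rewrite inE negb_or neq_lt; apply/andP; split; last by near: y.
near: y; case/orP: xs => xs.
  by apply: filterS (lt_nbhsl xs) => y ->.
by apply: filterS (lt_nbhsr xs) => y ->; rewrite orbT.
Unshelve. all: by end_near. Qed.

(** The point [x] may itself lie in [S]: it is first deleted from the list, and [x < y] then
    excludes it. *)
Lemma near_right_notin S x : \forall y \near x^'+, y \notin S.
Proof.
have : x \notin [seq y <- S | y != x] by rewrite mem_filter eqxx.
move=> /near_notin; apply: filterS => y + xy.
by rewrite mem_filter /= gt_eqF.
Qed.

Lemma near_left_notin S x : \forall y \near x^'-, y \notin S.
Proof.
have : x \notin [seq y <- S | y != x] by rewrite mem_filter eqxx.
move=> /near_notin; apply: filterS => y + xy.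
by rewrite mem_filter /= lt_eqF.
Qed.

Lemma derive1_is_derive f f1 : (forall x, is_derive x 1 f (f1 x)) -> f^`() = f1.
Proof. by move=> ff1; apply/funext => x; rewrite derive1E; have [] := ff1 x. Qed.

Lemma pC2_C1 S f f1 f2 : piecewise_C2 S f f1 f2 -> C1 f.
Proof.
move=> fC; split; first by move=> x; have [] := pC2_derive fC x.
by rewrite (derive1_is_derive (pC2_derive fC)); exact: pC2_continuous1 fC.
Qed.

Lemma pC2_derive2 S f f1 f2 x : piecewise_C2 S f f1 f2 ->
  x \notin S -> f^`(2) x = f2 x.
Proof.
move=> fC xS; rewrite derive1nS derive1n1 (derive1_is_derive (pC2_derive fC)).
by rewrite derive1E; have [] := pC2_derive1 fC xS.
Qed.

(** Just to the right of [x] there is no point of [S], so the true second derivative coincides there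
    with [f2], even when [x] is in [S]. *)
Lemma pC2_cvg_right S f f1 f2 x (l : R) : piecewise_C2 S f f1 f2 ->
  f2 y @[y --> x^'+] --> l -> f^`(2) y @[y --> x^'+] --> l.
Proof.
move=> fC; apply: cvg_trans; apply: near_eq_cvg.
apply: filterS (near_right_notin S x) => y.
by move=> /(pC2_derive2 fC).
Qed.

Lemma pC2_cvg_left S f f1 f2 x (l : R) : piecewise_C2 S f f1 f2 ->
  f2 y @[y --> x^'-] --> l -> f^`(2) y @[y --> x^'-] --> l.
Proof.
move=> fC; apply: cvg_trans; apply: near_eq_cvg.
apply: filterS (near_left_notin S x) => y.
by move=> /(pC2_derive2 fC).
Qed.

Lemma pC2_one_sided S f f1 f2 x : piecewise_C2 S f f1 f2 ->
  has_one_sided_limits f^`(2) x.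
Proof.
move=> fC; have [/cvg_ex[/= r fr] /cvg_ex[/= l fl]] := pC2_limits2 fC x.
split; apply/cvg_ex; [exists r|exists l].
- exact: pC2_cvg_right fC fr.
- exact: pC2_cvg_left fC fl.
Qed.

Lemma pC2_piecewise S f f1 f2 : piecewise_C2 S f f1 f2 ->
  piecewise_second_derivative f.
Proof.
move=> fC; exists S; split.
- move=> x xS; rewrite (derive1_is_derive (pC2_derive fC)).
  by have [] := pC2_derive1 fC xS.
- split; last by move=> x _; exact: pC2_one_sided fC.
  move=> x xS; rewrite /prop_for /continuous_at (pC2_derive2 fC xS).
  apply: cvg_trans (pC2_continuous2 fC xS); apply: near_eq_cvg.
  by apply: filterS (near_notin xS) => y /(pC2_derive2 fC).
- have [M fM] := pC2_bounded2 fC; exists M => x xS.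
  by rewrite (pC2_derive2 fC xS).
Qed.

Lemma one_sided_continuous f x : {for x, continuous f} -> has_one_sided_limits f x.
Proof.
by move=> fx; split; apply/cvg_ex; exists (f x);
  [exact: cvg_at_right_filter|exact: cvg_at_left_filter].
Qed.

End PiecewiseC2.

(** * The bump moved to a node [c] and shrunk to radius [r] *)

Section ScaledBump.
Context {R : realType}.
Variables (a b c r : R).
Hypothesis r_gt0 : 0 < r.
Implicit Types x y : R.

Let u y : R := (y - c) / r.

Definition scaled_bump y : R := r ^+ 2 * bump a b (u y).
Definition scaled_bump1 y : R := r * bump1 a b (u y).
Definition scaled_bump2 y : R := bump2 a b (u y).

Let is_derive_u x : is_derive x 1 u r^-1.
Proof. by rewrite /u; apply: is_derive_eq; rewrite /GRing.scale/=; ring. Qed.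

Let continuous_u : continuous u.
Proof. exact: continuous_of_is_derive is_derive_u. Qed.

Let continuous_aux d : continuous (bump2_aux a b d \o u).
Proof.
move=> x; apply: (cvg_comp u); first exact: continuous_u.
exact: continuous_bump2_aux.
Qed.

Let cvg_aux_center d : bump2_aux a b d (u y) @[y --> c] --> d.
Proof.
have := @continuous_aux d c.
by rewrite /continuous_at /= {2}/u subrr mul0r bump2_aux0.
Qed.

Lemma scaled_bump_supp x : r <= `|x - c| ->
  [/\ scaled_bump x = 0, scaled_bump1 x = 0 & scaled_bump2 x = 0].
Proof.
move=> rx; rewrite /scaled_bump /scaled_bump1 /scaled_bump2.
have [|-> -> ->] := @bump_supp R a b (u x); last by rewrite !mulr0.
by rewrite normrM normfV (gtr0_norm r_gt0) ler_pdivlMr// mul1r.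
Qed.

Lemma scaled_bump_le x : r <= 1 ->
  `|scaled_bump x| <= r * bump_bound a b /\
  `|scaled_bump1 x| <= r * bump_bound a b.
Proof.
move=> r1; have [b0 b1 _] := bump_le a b (u x).
split; rewrite normrM ?normrX (gtr0_norm r_gt0); last by rewrite ler_pM2l.
(* One of the two factors [r] is discarded by [r <= 1]. *)
by rewrite expr2 -mulrA ler_pM2l// (le_trans _ b0)// ler_piMl.
Qed.

(** To the right of [c] the slope factor is constantly [a], so the function agrees there with the
    continuous [bump2_aux a b a \o u], whose value at [c] is [a]. *)
Lemma scaled_bump2_right : scaled_bump2 y @[y --> c^'+] --> a.
Proof.
have /cvg_at_right_filter := cvg_aux_center (d := a).
apply: cvg_trans; apply: near_eq_cvg; near=> y.
have uy : 0 < u y by rewrite divr_gt0// subr_gt0.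
by rewrite /scaled_bump2 /bump2 /side_slope uy ltNge (ltW uy) mulr1 mulr0 addr0.
Unshelve. all: by end_near. Qed.

Lemma scaled_bump2_left : scaled_bump2 y @[y --> c^'-] --> b.
Proof.
have /cvg_at_left_filter := cvg_aux_center (d := b).
apply: cvg_trans; apply: near_eq_cvg; near=> y.
have uy : u y < 0 by rewrite pmulr_llt0 ?invr_gt0// subr_lt0.
by rewrite /scaled_bump2 /bump2 /side_slope uy ltNge (ltW uy) mulr1 mulr0 add0r.
Unshelve. all: by end_near. Qed.

Lemma scaled_bump2_continuous x : x != c -> {for x, continuous scaled_bump2}.
Proof.
move=> xc; rewrite /prop_for /continuous_at.
(* The slope is frozen at its value at [x]; it is constant on the side of [c] that contains [x]. *)
apply: cvg_trans (@continuous_aux (side_slope a b (u x)) x).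
apply: near_eq_cvg; move: xc; rewrite neq_lt => /orP[xc|xc]; near=> y.
- have neg z : z < c -> u z < 0.
    by move=> zc; rewrite pmulr_llt0 ?invr_gt0// subr_lt0.
  have yc : y < c by near: y; exact: lt_nbhsl.
  by rewrite /scaled_bump2 /bump2 /side_slope/= !neg// !ltNge !ltW ?neg.
- have pos z : c < z -> 0 < u z by move=> zc; rewrite divr_gt0// subr_gt0.
  have yc : c < y by near: y; exact: lt_nbhsr.
  by rewrite /scaled_bump2 /bump2 /side_slope/= !pos// !ltNge !ltW ?pos.
Unshelve. all: by end_near. Qed.

Lemma scaled_bump_C2 S : c \in S ->
  piecewise_C2 S scaled_bump scaled_bump1 scaled_bump2.
Proof.
move=> cS; have r0 : r != 0 by rewrite gt_eqF.
have noteq x : x \notin S -> x != c by apply: contraNneq => ->.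
split.
- move=> x; have dc := is_derive1_comp (is_derive_bump a b (u x)) (is_derive_u x).
  rewrite /scaled_bump; apply: is_derive_eq.
  by rewrite /GRing.scale/= /scaled_bump1; field.
- move=> x; apply: cvgM; first exact: cvg_cst.
  apply: (cvg_comp u); first exact: continuous_u.
  exact: continuous_bump1.
- move=> x /noteq xc; have ux : u x != 0 by rewrite mulf_neq0 ?invr_eq0// subr_eq0.
  have dc := is_derive1_comp (is_derive_bump1 a b ux) (is_derive_u x).
  rewrite /scaled_bump1; apply: is_derive_eq.
  by rewrite /GRing.scale/= /scaled_bump2; field.
- by move=> x /noteq; exact: scaled_bump2_continuous.
- move=> x; have [->|xc] := eqVneq x c; last first.
    by apply: one_sided_continuous; exact: scaled_bump2_continuous.
  split; apply/cvg_ex; [exists a|exists b].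
  + exact: scaled_bump2_right.
  + exact: scaled_bump2_left.
- by exists (bump_bound a b) => x; have [] := bump_le a b (u x).
Qed.

End ScaledBump.

(** * Perturbations of the identity by finite sums, and their inverses *)

Lemma pC2_id_sum (R : realType) (m : nat) (S : seq R) (f f1 f2 : 'I_m -> R -> R) :
  (forall k, piecewise_C2 S (f k) (f1 k) (f2 k)) ->
  piecewise_C2 S (fun x => x + \sum_(k < m) f k x)
    (fun x => 1 + \sum_(k < m) f1 k x) (fun x => \sum_(k < m) f2 k x).
Proof.
move=> fC.
have cvg_sum (F : set_system R) (g : 'I_m -> R -> R) (l : 'I_m -> R) : Filter F ->
    (forall k, g k x @[x --> F] --> l k) ->
    \sum_(k < m) g k x @[x --> F] --> \sum_(k < m) l k.
  by move=> FF gl; apply: cvg_big => // -[x y]; exact: add_continuous.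
have sumE (g : 'I_m -> R -> R) : (fun x => \sum_(k < m) g k x) = \sum_(k < m) g k.
  by apply/funext => x; rewrite fct_sumE.
split.
- move=> x; apply: is_deriveD; rewrite sumE; apply: is_derive_sum => k.
  exact: pC2_derive (fC k) x.
- move=> x; apply: cvgD; first exact: cvg_cst.
  by apply: cvg_sum => k; exact: pC2_continuous1 (fC k) x.
- move=> x xS; rewrite -[X in is_derive _ _ _ X]add0r; apply: is_deriveD.
  by rewrite sumE; apply: is_derive_sum => k; exact: pC2_derive1 (fC k) x xS.
- by move=> x xS; apply: cvg_sum => k; exact: pC2_continuous2 (fC k) x xS.
- move=> x; split; apply/cvg_ex.
  + exists (\sum_k lim (f2 k y @[y --> x^'+])); apply: cvg_sum => k.
    by have [] := pC2_limits2 (fC k) x.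
  + exists (\sum_k lim (f2 k y @[y --> x^'-])); apply: cvg_sum => k.
    by have [] := pC2_limits2 (fC k) x.
- pose M k := sval (cid (pC2_bounded2 (fC k))).
  exists (\sum_k M k) => x; rewrite (le_trans (ler_norm_sum _ _ _))//.
  by apply: ler_sum => k _; rewrite /M; case: cid => /= N; apply.
Qed.

(** Since [g1 >= 1 - d > 0], [g] is strictly increasing by the mean value theorem; being at bounded
    distance from the identity, it is onto by the intermediate value theorem. The formulas for [h]
    come from differentiating [g (h y) = y] twice. *)
Lemma pC2_inverse (R : realType) (S : seq R) (g g1 g2 : R -> R) (d M : R) :
  d < 1 -> (forall x, `|g1 x - 1| <= d) -> (forall x, `|g x - x| <= M) ->
  piecewise_C2 S g g1 g2 ->
  exists h, [/\ cancel h g, cancel g h &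
    piecewise_C2 [seq g x | x <- S] h (fun y => (g1 (h y))^-1)
      (fun y => - g2 (h y) / g1 (h y) ^+ 3)].
Proof.
move=> d1 g1d gM gC.
have dg := pC2_derive gC; have cg := continuous_of_is_derive dg.
have cW x y : {within `[x, y], continuous g} by exact: continuous_subspaceT.
have g1_ge x : 1 - d <= g1 x.
  by have := g1d x; rewrite ler_norml => /andP[]; lra.
have g1_gt0 x : 0 < g1 x by apply: lt_le_trans (g1_ge x); rewrite subr_gt0.
have g1_neq0 x : g1 x != 0 by rewrite gt_eqF.
have incr : {homo g : x y / x < y}.
  move=> x y xy; rewrite -subr_gt0.
  have [z _ ->] := MVT xy (fun z _ => dg z) (cW x y).
  by rewrite mulr_gt0// subr_gt0.
have M0 : 0 <= M := le_trans (normr_ge0 _) (gM 0).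
have surj z : exists x, g x = z.
  (* The bound on [g x - x] gives [g (z - M) <= z <= g (z + M)]. *)
  have xy : z - M <= z + M by lra.
  have [|x _ gx] := IVT xy (cW _ _) (v := z); last by exists x.
  have := gM (z - M); have := gM (z + M); rewrite !ler_norml.
  move=> /andP[gl _] /andP[_ gr]; rewrite ge_min le_max.
  by apply/andP; split; apply/orP; [left|right]; lra.
pose h z := sval (cid (surj z)).
have hK : cancel h g by move=> z; rewrite /h; case: cid.
have injg : injective g.
  by move=> x y; case: (ltgtP x y) => // /incr + gxy; rewrite gxy ltxx.
have gK : cancel g h by move=> x; apply: injg; rewrite hK.
have dh (y : R) : is_derive y 1 h (g1 (h y))^-1.
  rewrite -{1}(hK y); apply: is_derive_inverse => //.
  - by near=> x; exact: gK.
  - by near=> x; exact: cg.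
have ch := continuous_of_is_derive dh.
have incrh : {homo h : x y / x < y}.
  move=> x y xy; rewrite -(leW_mono (le_mono incr)) !hK//.
have noth y : y \notin [seq g x | x <- S] -> h y \notin S.
  by rewrite -{1}(hK y) mem_map.
have cg1h : continuous (g1 \o h).
  by move=> y; apply: (cvg_comp h); [exact: ch|exact: (pC2_continuous1 gC)].
(* The denominator is continuous, so only the limit of [g2 \o h] matters. The filter is left general
   to cover full and one-sided neighbourhoods of [y] at once. *)
have cvgh2 (F : set_system R) y l : Filter F -> F `=>` nbhs y ->
    g2 (h z) @[z --> F] --> l ->
    - g2 (h z) / g1 (h z) ^+ 3 @[z --> F] --> - l / g1 (h y) ^+ 3.
  move=> FF Fy gl; apply: cvgM; first exact: cvgN.
  apply: cvgV; first by rewrite expf_neq0.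
  apply: (cvg_comp (g1 \o h) (fun x => x ^+ 3)); last exact: exprn_continuous.
  exact: cvg_trans (cvg_app _ Fy) (cg1h y).
exists h; split => //; split => //.
- by move=> y; apply: cvgV => //; exact: cg1h.
- move=> y /noth hyS.
  have dc := is_derive1_comp (pC2_derive1 gC hyS) (dh y).
  have := is_deriveV (g1_neq0 (h y)) dc => dV; apply: is_derive_eq.
  by rewrite /GRing.scale/=; field.
- move=> y /noth hyS; apply: cvgh2 => //.
  by apply: (cvg_comp h); [exact: ch|exact: (pC2_continuous2 gC)].
- move=> y; have [/cvg_ex[/= r gr] /cvg_ex[/= l gl]] := pC2_limits2 gC (h y).
  split; apply/cvg_ex.
  + exists (- r / g1 (h y) ^+ 3); apply: cvgh2; first exact: cvg_within.
    (* An increasing [h] sends right neighbourhoods of [y] to right neighbourhoods of [h y], so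
       sides are preserved. *)
    apply: (@increasing_cvg_at_right_comp _ h g2 y +oo%O) => //.
      by move=> x z _ _; exact: incrh.
    by apply: cvg_at_right_filter; exact: ch.
  + exists (- l / g1 (h y) ^+ 3); apply: cvgh2; first exact: cvg_within.
    apply: (@increasing_cvg_at_left_comp _ h g2 -oo%O y) => //.
      by move=> x z _ _; exact: incrh.
    by apply: cvg_at_left_filter; exact: ch.
(* The denominator is at least [(1 - d) ^+ 3] by the lower bound on [g1]. *)
- have [N gN] := pC2_bounded2 gC; exists (N / (1 - d) ^+ 3) => y.
  have d0 : 0 < 1 - d by rewrite subr_gt0.
  rewrite normrM normrN normfV (ger0_norm (exprn_ge0 _ (ltW (g1_gt0 _)))).
  apply: ler_pM => //; first by rewrite invr_ge0 exprn_ge0// ltW.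
  by rewrite lef_pV2 ?posrE ?exprn_gt0// lerXn2r// nnegrE ltW.
Unshelve. all: by end_near. Qed.

(** * Choice of the radius and assembly of [g] and [h] *)

Lemma sup_norm_le (R : realType) (f : R -> R) (c : R) :
  (forall x, `|f x| <= c) -> (sup_norm f <= c%:E)%E.
Proof. by move=> fc; apply: ge_ereal_sup => _ [x _ <-]; rewrite lee_fin. Qed.

(** Each condition holds for all small enough positive [r], and there are finitely many; injectivity
    makes every gap between nodes positive. *)
Lemma small_radius (R : realType) (m : nat) (xi : 'I_m -> R) (B e : R) :
  injective xi -> 0 < e -> exists r : R,
    [/\ 0 < r, r <= 1, forall j k, j != k -> r <= `|xi j - xi k| & r * B <= e].
Proof.
move=> xi_inj e0; near (0 : R)^'+ => r; exists r; split.
- by near: r; exact: nbhs_right_gt.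
- by near: r; exact: nbhs_right_le.
- near: r; apply: filter_forall => j; apply: filter_forall => k.
  have [->|jk] := eqVneq j k; first exact: nearW.
  apply: filterS (nbhs_right_le (x := 0) (z := `|xi j - xi k|) _) => //.
  by rewrite normr_gt0 subr_eq0 inj_eq.
(* [B] may be zero or negative, so the division is by [|B| + 1] instead. *)
- have B0 : 0 < `|B| + 1 by rewrite ltr_wpDl.
  have r0 : 0 < r by near: r; exact: nbhs_right_gt.
  have rB : r <= e / (`|B| + 1) by near: r; apply: nbhs_right_le; rewrite divr_gt0.
  rewrite ler_pdivlMr// in rB; apply: le_trans rB.
  by rewrite ler_pM2l// (le_trans (ler_norm B))// lerDl.
Unshelve. all: by end_near. Qed.

Theorem proposition2p4 (R : realType) (m : nat) (m_ge1 : (1 <= m)%N)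
    (xi alpha beta : 'I_m -> R)
    (xi_incr : forall i j : 'I_m, (i < j)%N -> xi i < xi j)
    (kappa : R) (kappa_gt0 : 0 < kappa) (kappa_lt1 : kappa < 1) :
  exists g h : R -> R,
    ((forall z, g (h z) = z) /\ (forall x, h (g x) = x)) /\
    (C1 g /\ C1 h) /\
    ((sup_norm (fun x => (derive1 g x - 1)%R) <= kappa%:E)%E /\
     (sup_norm (fun x => (derive1 h x - 1)%R) <= kappa%:E)%E) /\
    ((sup_norm (fun x => (g x - x)%R) <=
       (kappa / 2 * Num.max 1 (\big[Num.max/1]_(k < m) (next_node xi k - xi k)))%R%:E)%E /\
     (exists M : R, forall x, M < `|x| -> g x = x)) /\
    ((piecewise_second_derivative g /\ piecewise_second_derivative h) /\
     (forall k, has_one_sided_limits g^`(2) (xi k) /\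
                has_one_sided_limits h^`(2) (g (xi k)))) /\
    (forall k, g^`(2) x @[x --> (xi k)^'+] --> alpha k /\
               g^`(2) x @[x --> (xi k)^'-] --> beta k).

Proof.
have xi_inj : injective xi.
  move=> i j xij; apply/val_inj; case: (ltngtP i j) => // /xi_incr;
  by rewrite xij ltxx.
pose B := \sum_(k < m) bump_bound (alpha k) (beta k).
(* Since [r] is only bounded by the gaps, neighbouring bumps may overlap; hence [B] adds the bounds
   of all of them. *)
have [r [r0 r1 rgap rB]] := small_radius B xi_inj (divr_gt0 kappa_gt0 (ltr0n _ 2)).
pose f k := scaled_bump (alpha k) (beta k) (xi k) r.
pose f1 k := scaled_bump1 (alpha k) (beta k) (xi k) r.
pose f2 k := scaled_bump2 (alpha k) (beta k) (xi k) r.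
pose S := [seq xi k | k <- enum 'I_m].
pose g x := x + \sum_k f k x.
pose g1 x := 1 + \sum_k f1 k x.
pose g2 x := \sum_k f2 k x.
have fC k : piecewise_C2 S (f k) (f1 k) (f2 k).
  by apply: scaled_bump_C2 => //; rewrite map_f ?mem_enum.
have gC : piecewise_C2 S g g1 g2 := pC2_id_sum fC.
have sum_le (u : 'I_m -> R) :
    (forall k, `|u k| <= r * bump_bound (alpha k) (beta k)) ->
    `|\sum_k u k| <= kappa / 2.
  move=> uB; rewrite (le_trans _ rB)// (le_trans (ler_norm_sum _ _ _))//.
  by rewrite mulr_sumr ler_sum.
have gx x : `|g x - x| <= kappa / 2.
  rewrite /g addrAC subrr add0r sum_le// => k.
  by have [] := scaled_bump_le (alpha k) (beta k) (xi k) r0 x r1.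
have g1x x : `|g1 x - 1| <= kappa / 2.
  rewrite /g1 addrAC subrr add0r sum_le// => k.
  by have [] := scaled_bump_le (alpha k) (beta k) (xi k) r0 x r1.
have k2 : kappa / 2 < 1 by lra.
have [h [gK hK hC]] := pC2_inverse k2 g1x gx gC.
exists g, h; split; first by [].
split; first by split; [exact: pC2_C1 gC|exact: pC2_C1 hC].
split.
  split; apply: sup_norm_le => x.
    by rewrite (derive1_is_derive (pC2_derive gC)) (le_trans (g1x x))//; lra.
  rewrite (derive1_is_derive (pC2_derive hC)).
  have := g1x (h x); set t := g1 (h x); rewrite ler_norml => /andP[tl tr].
  have t0 : 0 < t by lra.
  (* Here [|1 - t| <= kappa / 2] and [t >= 1 - kappa / 2 > 1 / 2], so the quotient is at most
     [kappa] in absolute value. *)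
  have -> : t^-1 - 1 = (1 - t) / t by field; rewrite gt_eqF.
  rewrite normrM normfV (gtr0_norm t0) ler_pdivrMr// ler_norml.
  by apply/andP; split; nra.
split.
  split.
    apply: sup_norm_le => x; rewrite (le_trans (gx x))//.
    (* The maximum is at least 1, so the bound [kappa / 2] is enough. *)
    by rewrite ler_peMr ?divr_ge0 ?(ltW kappa_gt0)// le_max lexx.
  (* Beyond this threshold [x] is at distance at least [1 >= r] from every node, so all bumps
     vanish. *)
  exists (1 + \sum_k `|xi k|) => x xM; rewrite /g big1 ?addr0// => k _.
  have [|fx _ _] := scaled_bump_supp (alpha k) (beta k) (c := xi k) r0 (x := x);
    last exact: fx.
  rewrite (le_trans r1)// (le_trans _ (lerB_dist _ _))// lerBrDr.
  rewrite (le_trans _ (ltW xM))// lerD2l (bigD1 k)//= lerDl.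
  by apply: sumr_ge0.
split.
  split; first by split; [exact: pC2_piecewise gC|exact: pC2_piecewise hC].
  by move=> k; split; [exact: pC2_one_sided gC|exact: pC2_one_sided hC].
move=> k.
(* The other nodes are at distance at least [r] from [xi k], so only the bump of index [k]
   contributes to the one-sided limits there. *)
have f2k j : j != k -> {for xi k, continuous (f2 j)} /\ f2 j (xi k) = 0.
  rewrite eq_sym => kj; split.
    by apply: scaled_bump2_continuous => //; rewrite inj_eq.
  by have [] := scaled_bump_supp (alpha j) (beta j) r0 (rgap _ _ kj).
have cvg_g2 (F : set_system R) (l : R) : Filter F -> F `=>` nbhs (xi k) ->
    f2 k y @[y --> F] --> l -> g2 y @[y --> F] --> l.
  move=> FF Fk fl.
  (* The limit is spread over the index set so that it can be taken term by term. *)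
  have -> : l = \sum_j (if j == k then l else 0) by rewrite -big_mkcond big_pred1_eq.
  apply: cvg_big => [|j _]; first by move=> [x y]; exact: add_continuous.
  have [->//|jk] := eqVneq j k.
  have [fc <-] := f2k j jk; exact: cvg_trans (cvg_app _ Fk) fc.
split.
- apply: (pC2_cvg_right gC); apply: cvg_g2; first exact: cvg_within.
  exact: scaled_bump2_right.
- apply: (pC2_cvg_left gC); apply: cvg_g2; first exact: cvg_within.
  exact: scaled_bump2_left.
Qed.
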